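(* Let $T$ be a tree of order $n$. Then $IC(T)=n-1$ if and only if $T\in\{P_5,P_6,S_{1,2},K_{1,3}\}$ (up to isomorphism).
   Context: Graphs are finite and simple. $P_n$ is the path of order $n$; $K_{1,3}$ is the star of order 4; $S_{p,q}$ is the double star, i.e. the tree consisting of two adjacent (support) vertices with respectively $p$ and $q$ leaves attached to them. A set $S$ of vertices is dominating if every vertex is in $S$ or adjacent to a vertex of $S$; it is independent if its vertices are pairwise nonadjacent; an independent dominating set is a set that is both independent and dominating. An independent coalition in $G$ consists of two disjoint independent sets of vertices $V_1,V_2$, neither of which is an independent dominating set but whose union $V_1\cup V_2$ is an independent dominating set; one says that $V_1$ and $V_2$ form an independent coalition. An $ic$-partition of $G$ is a partition $\pi=\{V_1,\dots,V_k\}$ of $V(G)$ into nonempty sets such that every $V_i\in\pi$ either is a singleton dominating set (a dominating set of cardinality 1), or is not an independent dominating set but forms an independent coalition with another set $V_j\in\pi$. The independent coalition number $IC(G)$ is the maximum number of classes of an $ic$-partition of $G$; the assertion $IC(G)=t$ includes that $G$ has an $ic$-partition. *)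

(* Defs.v *)
From mathcomp Require Import all_boot.
Set Implicit Arguments.
Unset Strict Implicit.
Unset Printing Implicit Defensive.

Record sgraph := SGraph {
  svertex :> finType;
  sedge : rel svertex;
  sedge_sym : symmetric sedge;
  sedge_irrefl : irreflexive sedge
}.

Arguments sedge {s}.

Definition isomorphic (G H : sgraph) : Prop :=
  exists2 f : G -> H, bijective f & forall x y, sedge (f x) (f y) = sedge x y.

(* Connectedness includes being nonempty. *)
Definition connected (G : sgraph) : Prop :=
  0 < #|G| /\ forall x y : G, connect sedge x y.

(* [ucycle] also accepts x :: y :: [::] for an edge xy (and the empty
   sequence), so only sequences of at least 3 vertices count as cycles. *)
Definition acyclic (G : sgraph) : Prop :=
  forall c : seq G, 2 < size c -> ~ ucycle sedge c.

Definition is_tree (G : sgraph) : Prop := connected G /\ acyclic G.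

Section PathGraph.
Variable n : nat.

Definition path_rel : rel 'I_n := fun i j => (i.+1 == j) || (j.+1 == i).

Lemma path_rel_sym : symmetric path_rel.
Proof. by move=> i j; rewrite /path_rel orbC. Qed.

Lemma path_rel_irrefl : irreflexive path_rel.
Proof. by move=> i; rewrite /path_rel orbb gtn_eqF. Qed.

Definition path_graph := SGraph path_rel_sym path_rel_irrefl.
End PathGraph.

Section CompleteBipartite.
Variables p q : nat.

Definition bipartite_rel : rel ('I_p + 'I_q) :=
  fun x y => match x, y with
             | inl _, inr _ | inr _, inl _ => true
             | _, _ => false
             end.

Lemma bipartite_rel_sym : symmetric bipartite_rel.
Proof. by move=> [i|i] [j|j]. Qed.

Lemma bipartite_rel_irrefl : irreflexive bipartite_rel.
Proof. by move=> [i|i]. Qed.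

Definition complete_bipartite := SGraph bipartite_rel_sym bipartite_rel_irrefl.
End CompleteBipartite.

(* The support vertices are [inl true], carrying the leaves [inr (inl _)],
   and [inl false], carrying the leaves [inr (inr _)]. *)
Section DoubleStar.
Variables p q : nat.

Definition double_star_rel : rel (bool + ('I_p + 'I_q)) :=
  fun x y => match x, y with
             | inl b, inl c => b != c
             | inl b, inr (inl _) | inr (inl _), inl b => b
             | inl b, inr (inr _) | inr (inr _), inl b => ~~ b
             | inr _, inr _ => false
             end.

Lemma double_star_rel_sym : symmetric double_star_rel.
Proof. by move=> [b|[i|i]] [c|[j|j]] //=; rewrite eq_sym. Qed.

Lemma double_star_rel_irrefl : irreflexive double_star_rel.
Proof. by move=> [b|[i|i]] //=; rewrite eqxx. Qed.

Definition double_star := SGraph double_star_rel_sym double_star_rel_irrefl.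
End DoubleStar.

Section IndependentCoalition.
Variable G : sgraph.
Implicit Types (S A B : {set G}) (P : {set {set G}}).

Definition dominating S : bool :=
  [forall v, (v \in S) || [exists u in S, sedge v u]].

Definition independent S : bool :=
  [forall u in S, forall v in S, ~~ sedge u v].

Definition ind_dominating S : bool := independent S && dominating S.

Definition ind_coalition A B : bool :=
  [&& [disjoint A & B], independent A, independent B,
      ~~ ind_dominating A, ~~ ind_dominating B & ind_dominating (A :|: B)].

(* [partition P setT] requires the classes to be nonempty. *)
Definition ic_partition P : bool :=
  partition P [set: G] &&
  [forall A in P,
     ((#|A| == 1) && dominating A) ||
     (~~ ind_dominating A && [exists B in P, ind_coalition A B])].

(* IC(G) = t, as a relation because a graph may have no ic-partition. *)
Definition IC_is (t : nat) : Prop :=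
  (exists2 P, ic_partition P & #|P| = t) /\
  (forall P, ic_partition P -> #|P| <= t).

End IndependentCoalition.

(* Main.v *)
Require Import Defs.
From mathcomp Require Import all_boot zify.
Set Implicit Arguments.
Unset Strict Implicit.
Unset Printing Implicit Defensive.

(** A proper subset of an independent dominating set is never dominating, so two
   disjoint nonempty sets form an independent coalition exactly when their union
   is an independent dominating set ([ind_coalitionE]). In an ic-partition of a
   graph of order n into n - k classes, the classes exceed singletons by k
   vertices in total, so every vertex lies in an independent dominating set of
   at most k + 2 vertices ([ic_partition_small]).

   For k = 1 and a connected graph this leaves three facts
   ([ic_partition_pred_card]): every vertex lies in an independent dominating
   set of at most three vertices, some such set has exactly three, and some such
   set has at most two. They determine a tree ([tree_classification]):

   - If one vertex c dominates, a leaf forces all leaves into its set, so the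
     tree is the star with three leaves. Otherwise the order is at least five.

   - If {u, v} is an independent dominating set and u, v have a common neighbour
     x, then, in the absence of cycles, an independent dominating set through x
     contains everything except u and v. So the order is five, and the two
     vertices besides u, x, v are leaves at u or v: both at the same one for
     S_{1,2}, one at each for P_5.

   - If {u, v} is an independent dominating set without common neighbour, there
     is a path u x y v. When u is a leaf, {x, v} is a pair of the previous kind,
     and likewise {u, y} when v is. Otherwise a set through x contains all
     neighbours of u, besides something that dominates v, so u has degree two;
     the same holds for v, and the tree is P_6.

   Isomorphisms are built from injective homomorphisms, which from a connected
   graph to an acyclic one reflect adjacency ([embedding_reflects_edges]).

   Conversely, in each of the four graphs some vertex lies in no independent
   dominating set of at most two vertices, which excludes n classes, and merging
   a suitable pair of vertices gives n - 1 of them; both are finite checks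
   ([merge_certificate_IC]). *)

(** * Independent dominating sets and ic-partitions *)

Section IndependentDomination.
Variable G : sgraph.
Implicit Types (S A B : {set G}) (P : {set {set G}}).

Lemma sedge_neq (x y : G) : sedge x y -> x != y.
Proof. by apply: contraTneq => ->; rewrite sedge_irrefl. Qed.

Lemma dominatingP S :
  reflect (forall v, v \in S \/ exists2 u, u \in S & sedge v u) (dominating S).
Proof.
apply: (iffP forallP) => domS v; move: (domS v).
  by case/orP=> [|/exists_inP]; [left | right].
by case=> [->//|/exists_inP ->]; rewrite orbT.
Qed.

Lemma independentP S :
  reflect {in S &, forall u v, ~~ sedge u v} (independent S).
Proof.
apply: (iffP forall_inP) => indS u; first by move=> v uS; move/forall_inP: (indS u uS); apply.
by move=> uS; apply/forall_inP => v; apply: indS.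
Qed.

Lemma independentS A S : A \subset S -> independent S -> independent A.
Proof.
move=> /subsetP sAS /independentP indS; apply/independentP => u v uA vA.
by apply: indS; apply: sAS.
Qed.

(** A vertex of [S] outside [A] has no neighbour in [S], hence none in [A]. *)
Lemma independent_dominating_sub A S :
  A \subset S -> independent S -> dominating A -> A = S.
Proof.
move=> sAS /independentP indS /dominatingP domA; apply/eqP.
rewrite eqEsubset sAS; apply/subsetP => v vS.
case: (domA v) => // -[u uA]; rewrite (negPf (indS _ _ vS _)) //.
exact: (subsetP sAS).
Qed.

(** By minimality of independent dominating sets, the requirements that a
   coalition puts on each of its two sets separately all follow from the one on
   their union. *)
Lemma ind_coalitionE A B :
  A != set0 -> B != set0 ->
  ind_coalition A B = [disjoint A & B] && ind_dominating (A :|: B).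
Proof.
move=> A0 B0; rewrite /ind_coalition.
case dAB: [disjoint A & B] => //=.
case idAB: (ind_dominating (A :|: B)); rewrite ?andbF // !andbT.
have /andP[indAB _] := idAB.
rewrite (independentS (subsetUl A B) indAB) (independentS (subsetUr A B) indAB).
rewrite /=; apply/andP; split; apply/negP => /andP[_ dom].
  have eqA := independent_dominating_sub (subsetUl A B) indAB dom.
  case/set0Pn: B0 => b bB.
  by move: (disjointFl dAB bB); rewrite eqA inE bB orbT.
have eqB := independent_dominating_sub (subsetUr A B) indAB dom.
case/set0Pn: A0 => a aA.
by move: (disjointFr dAB aA); rewrite eqB inE aA.
Qed.

(** The form in which the definition is used: a partner is just a class whose
   union with [A] is an independent dominating set. *)
Lemma ic_partitionP P : partition P [set: G] ->
  reflect (forall A, A \in P -> (#|A| = 1 /\ dominating A) \/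
             exists2 B, B \in P & B != A /\ ind_dominating (A :|: B))
          (ic_partition P).
Proof.
move=> partP; rewrite /ic_partition partP /=.
have triv := trivIsetP (partition_trivIset partP).
have ne0 := partition_neq0 partP.
have coalE A B : A \in P -> B \in P ->
    ind_coalition A B = (B != A) && ind_dominating (A :|: B).
  move=> AP BP; rewrite ind_coalitionE ?ne0 //; congr (_ && _).
  case: eqVneq => [->|nBA]; last by apply: triv => //; rewrite eq_sym.
  by rewrite -setI_eq0 setIid; apply: negPf; apply: ne0.
apply: (iffP forall_inP) => icP A AP.
  case/orP: (icP A AP) => [/andP[/eqP A1 domA]|/andP[_ /exists_inP[B BP]]]; first by left.
  by rewrite coalE // => /andP[nBA idAB]; right; exists B.
case: (icP A AP) => [[-> ->] //|[B BP [nBA idAB]]].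
have coal: ind_coalition A B by rewrite coalE // nBA.
apply/orP; right; have /and5P[_ _ _ -> _] /= := coal.
by apply/exists_inP; exists B.
Qed.

(** Counting each class one vertex short measures how far the partition is from
   the partition into singletons. *)
Lemma sum_excess P : partition P [set: G] -> \sum_(A in P) #|A|.-1 + #|P| = #|G|.
Proof.
move=> partP; rewrite -cardsT (card_partition partP) -sum1_card -big_split /=.
apply: eq_bigr => A AP; rewrite addn1 prednK // card_gt0.
exact: (partition_neq0 partP).
Qed.

Lemma two_class_excess P A B : partition P [set: G] ->
  A \in P -> B \in P -> B != A -> #|A|.-1 + #|B|.-1 + #|P| <= #|G|.
Proof.
move=> partP AP BP nBA; rewrite -(sum_excess partP) leq_add2r (bigD1 A) //=.
by rewrite leq_add2l (bigD1 B) /= ?leq_addr // BP.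
Qed.

Lemma independent_set1 (x : G) : independent [set x].
Proof. by apply/independentP => u v /set1P-> /set1P->; rewrite sedge_irrefl. Qed.

Lemma ind_dominating_card1 A : #|A| = 1 -> dominating A -> ind_dominating A.
Proof. by move/eqP/cards1P => [x ->]; rewrite /ind_dominating independent_set1. Qed.

(** A class and its partner have, beyond one vertex each, at most as many
   vertices as the partition lacks classes. *)
Lemma ic_partition_class_sub P : ic_partition P ->
  forall A, A \in P -> exists S,
    [/\ A \subset S, ind_dominating S & #|S| <= (#|G| - #|P|).+2].
Proof.
move=> icP A AP; have partP : partition P [set: G] by case/andP: icP.
case/(ic_partitionP partP)/(_ _ AP): icP => [[A1 domA]|[B BP [nBA idAB]]].
  by exists A; split=> //; [apply: ind_dominating_card1 | rewrite A1].
exists (A :|: B); rewrite subsetUl; split=> //.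
have := two_class_excess partP AP BP nBA; have [leU _] := leq_card_setU A B.
move: leU; lia.
Qed.

Lemma ic_partition_small P (v : G) : ic_partition P -> exists S,
  [/\ v \in S, ind_dominating S & #|S| <= (#|G| - #|P|).+2].
Proof.
move=> icP; have partP : partition P [set: G] by case/andP: icP.
have vP : v \in cover P by rewrite (cover_partition partP) inE.
have [S [sPS idS leS]] := ic_partition_class_sub icP (pblock_mem vP).
by exists S; split=> //; apply: (subsetP sPS); rewrite mem_pblock.
Qed.

End IndependentDomination.

(** * Order minus one classes in a connected graph *)

Lemma connected_neighbour (G : sgraph) (x : G) :
  connected G -> 1 < #|G| -> exists y, sedge x y.
Proof.
move=> [_ conn] /card_gt1P[a [b [_ _ nab]]].
have [y nyx] : exists y, y != x.
  by case: (eqVneq a x) => [<-|]; [exists b; rewrite eq_sym | exists a].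
case/connectP: (conn x y) => -[|z p] /=; first by move=> _ /eqP; rewrite (negPf nyx).
by case/andP; exists z.
Qed.

Lemma independent_ltn_card (G : sgraph) (S : {set G}) :
  connected G -> 1 < #|G| -> independent S -> S != set0 -> #|S| < #|G|.
Proof.
move=> conG G1 /independentP indS /set0Pn[x xS].
have [y xy] := connected_neighbour x conG G1.
rewrite -cardsT; apply: proper_card; rewrite properT.
by apply: contraTneq xy => eqS; apply: indS; rewrite ?xS // eqS inE.
Qed.

(** With one class fewer than vertices, the partition has one class of two
   vertices, and all the other classes are singletons. The pair and its partner
   form the independent dominating set of three vertices. *)
Lemma ic_partition_pred_card (G : sgraph) (P : {set {set G}}) :
  connected G -> ic_partition P -> #|P| = #|G| - 1 ->
  [/\ forall v : G, exists S : {set G}, [/\ v \in S, ind_dominating S & #|S| <= 3],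
      exists2 S : {set G}, ind_dominating S & #|S| = 3
    & exists2 S : {set G}, ind_dominating S & #|S| <= 2].
Proof.
move=> conG icP cardP; have G0 : 0 < #|G| by case: conG.
have partP : partition P [set: G] by case/andP: icP.
have gapP : (#|G| - #|P|).+2 = 3 by lia.
have exc := sum_excess partP.
have [A AP A1] : exists2 A, A \in P & 1 < #|A|.
  apply/exists_inP; apply: contraT => /exists_inPn small.
  move: exc; rewrite big1 => [|A /small]; lia.
have cardB B : B \in P -> B != A -> #|B| = 1.
  move=> BP nBA; have := two_class_excess partP AP BP nBA.
  have := partition_neq0 partP BP; rewrite -card_gt0; lia.
have [C CP [nCA idAC]] : exists2 B, B \in P & B != A /\ ind_dominating (A :|: B).
  by case/(ic_partitionP partP)/(_ _ AP): icP => // -[]; lia.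
have G1 : 1 < #|G| by rewrite (leq_trans A1) // max_card.
split.
- by move=> v; have := ic_partition_small v icP; rewrite gapP.
- exists (A :|: C) => //.
  have dAC : [disjoint A & C].
    by apply: (trivIsetP (partition_trivIset partP)) => //; rewrite eq_sym.
  have := two_class_excess partP AP CP nCA.
  rewrite cardsU (disjoint_setI0 dAC) cards0 (cardB C) //; lia.
apply/exists_inP; apply: contraT => /exists_inPn no_small.
(* Otherwise [A] is the only possible partner of the other classes, and a
   neighbour [b] of a vertex [a] of [A] would share an independent set with
   it. *)
have [a aA] : exists a, a \in A by apply/set0Pn; rewrite -card_gt0; lia.
have [b ab] := connected_neighbour a conG G1.
have [B BP bB] : exists2 B, B \in P & b \in B.
  by apply/bigcupP; rewrite -/(cover P) (cover_partition partP) inE.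
suff [S /andP[/independentP indS _] [aS bS]] :
    exists2 S : {set G}, ind_dominating S & a \in S /\ b \in S.
  by move: (indS a b aS bS); rewrite ab.
have [BA|nBA] := eqVneq B A.
  by exists (A :|: C) => //; rewrite !inE aA -BA bB.
have B1 := cardB B BP nBA.
case/(ic_partitionP partP)/(_ _ BP): icP => [[_ domB]|[D DP [nDB idBD]]].
  by have := no_small _ (ind_dominating_card1 B1 domB); rewrite B1.
have [DA|nDA] := eqVneq D A; first by exists (B :|: D) => //; rewrite !inE bB DA aA orbT.
have := no_small _ idBD; rewrite -ltnNge ltnNge => /negP[].
by apply: leq_trans (leq_card_setU _ _).1 _; rewrite B1 cardB.
Qed.

(** * Isomorphisms with trees *)

(** A path of [H] between two vertices whose images are adjacent is mapped to a
   path that this adjacency closes into a cycle, so it consists of one edge. *)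
Lemma embedding_reflects_edges (H G : sgraph) (f : H -> G) :
  connected H -> acyclic G -> injective f ->
  {homo f : x y / sedge x y} -> {mono f : x y / sedge x y}.
Proof.
move=> [_ conH] acG injf homf x y; apply/idP/idP => [fxy|]; last exact: homf.
case/connectP: (conH x y) => p0 /shortenP[p pathp uniqp _] eqy.
case: p => [|z [|t p]] in pathp uniqp eqy *.
- by rewrite eqy sedge_irrefl in fxy.
- by case/andP: pathp => + _; rewrite eqy.
case: (acG (map f [:: x, z, t & p])) => //; apply/andP; split; last by rewrite map_inj_uniq.
rewrite (_ : cycle _ _ = path sedge (f x) (rcons (map f [:: z, t & p]) (f x))) //.
rewrite rcons_path; apply/andP; split; first exact: (homo_path homf).
by rewrite last_map -eqy sedge_sym.
Qed.

(** Hence only the edges of [H] have to be found in [G]. *)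
Lemma tree_isomorphic (H G : sgraph) (f : H -> G) :
  connected H -> acyclic G -> injective f ->
  {homo f : x y / sedge x y} -> #|H| = #|G| -> isomorphic G H.
Proof.
move=> conH acG injf homf eqHG.
have monof := embedding_reflects_edges conH acG injf homf.
have [g fK gK] : bijective f by apply: inj_card_bij => //; rewrite eqHG.
by exists g => [|x y]; [exists f | rewrite -monof !gK].
Qed.

Lemma connected_from (G : sgraph) (r : G) :
  (forall x, connect sedge r x) -> connected G.
Proof.
move=> conr; split; first by apply/card_gt0P; exists r.
by move=> x y; apply: connect_trans (conr y); rewrite (sym_connect_sym (@sedge_sym G)).
Qed.

Lemma path_graph_connected n : connected (path_graph n.+1).
Proof.
apply: (@connected_from (path_graph n.+1) ord0) => -[i lti].
elim: i lti => [|i IHi] lti; first by rewrite (_ : Ordinal lti = ord0) //; apply: val_inj.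
by apply: connect_trans (IHi (ltnW lti)) (connect1 _); rewrite /= /path_rel eqxx.
Qed.

Lemma complete_bipartite_connected q : connected (complete_bipartite 1 q).
Proof.
apply: (@connected_from (complete_bipartite 1 q) (inl ord0)) => -[i|j]; last exact: connect1.
by rewrite ord1.
Qed.

Lemma double_star_connected p q : connected (double_star p q).
Proof.
have c0 : @connect (double_star p q) sedge (inl true) (inl false) by apply: connect1.
apply: (@connected_from (double_star p q) (inl true)) => -[[]|[i|j]] //.
  exact: connect1.
by apply: connect_trans c0 (connect1 _).
Qed.

Lemma spanning_path_isomorphic (G : sgraph) (x : G) (s : seq G) :
  acyclic G -> path sedge x s -> uniq (x :: s) -> size (x :: s) = #|G| ->
  isomorphic G (path_graph (size (x :: s))).
Proof.
move=> acG paths uniqs sizes.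
pose f (i : path_graph (size (x :: s))) := nth x (x :: s) i.
have edgef i : i.+1 < size (x :: s) -> sedge (nth x (x :: s) i) (nth x (x :: s) i.+1).
  by move=> lti; apply: (pathP x paths).
apply: (@tree_isomorphic _ _ f) => //.
- exact: path_graph_connected.
- by move=> i j /eqP; rewrite nth_uniq // => /eqP /val_inj.
- move=> i j /orP[] /eqP eqij; rewrite /f -eqij; last rewrite sedge_sym.
    by apply: edgef; rewrite eqij.
  by apply: edgef; rewrite eqij.
- by rewrite card_ord.
Qed.

Lemma star_isomorphic (G : sgraph) (c : G) :
  acyclic G -> dominating [set c] -> isomorphic G (complete_bipartite 1 #|[set~ c]|).
Proof.
move=> acG /dominatingP domc.
have adjc z : z != c -> sedge z c.
  by move=> nzc; case: (domc z) => [/set1P/eqP|[u /set1P->]] //; rewrite (negPf nzc).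
pose f (x : complete_bipartite 1 #|[set~ c]|) : G :=
  match x with inl _ => c | inr j => enum_val j end.
have nf j : f (inr j) != c by have := enum_valP j; rewrite !inE.
apply: (@tree_isomorphic _ _ f) => //.
- exact: complete_bipartite_connected.
- move=> [i|i] [j|j] //; first by rewrite !ord1.
  + by move/esym/eqP; rewrite (negPf (nf _)).
  + by move/eqP; rewrite (negPf (nf _)).
  + by move/enum_val_inj => ->.
- move=> [i|i] [j|j] // _; last exact: adjc.
  by rewrite sedge_sym adjc.
- by rewrite card_sum !card_ord cardsC1; have := max_card (pred1 c); rewrite card1; lia.
Qed.

Lemma no_triangle (G : sgraph) (x y z : G) :
  acyclic G -> sedge x y -> sedge y z -> ~~ sedge z x.
Proof.
move=> acG xy yz; apply/negP => zx; apply: (acG [:: x; y; z]) => //.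
by rewrite /ucycle /= xy yz zx !inE negb_or !sedge_neq // sedge_sym.
Qed.

Lemma double_star_isomorphic (G : sgraph) (x y : G) :
  acyclic G -> sedge x y -> dominating [set x; y] ->
  isomorphic G (double_star #|[set z | sedge x z & z != y]|
                            #|[set z | sedge y z & z != x]|).
Proof.
move=> acG xy /dominatingP dom.
set X := [set z | _ & z != y]; set Y := [set z | _ & z != x].
pose f (v : double_star #|X| #|Y|) : G :=
  match v with
  | inl b => if b then x else y
  | inr (inl i) => enum_val i
  | inr (inr j) => enum_val j
  end.
have fX i : sedge x (f (inr (inl i))) /\ f (inr (inl i)) != y.
  by have := enum_valP i; rewrite !inE => /andP.
have fY j : sedge y (f (inr (inr j))) /\ f (inr (inr j)) != x.
  by have := enum_valP j; rewrite !inE => /andP.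
have nxy := sedge_neq xy.
have dXY : [disjoint X & Y].
  apply/pred0P => z /=; rewrite !inE; apply/negP => /andP[/andP[xz nzy] /andP[yz nzx]].
  by have := no_triangle acG xy yz; rewrite sedge_sym xz.
apply: (@tree_isomorphic _ _ f) => //.
- exact: double_star_connected.
- have nX i : (x == f (inr (inl i))) = false by apply: negPf; apply: sedge_neq (proj1 (fX i)).
  have nY i : (y == f (inr (inr i))) = false by apply: negPf; apply: sedge_neq (proj1 (fY i)).
  have nX' i : (y == f (inr (inl i))) = false by rewrite eq_sym; apply: negPf (proj2 (fX i)).
  have nY' i : (x == f (inr (inr i))) = false by rewrite eq_sym; apply: negPf (proj2 (fY i)).
  have nXY i j : (f (inr (inl i)) == f (inr (inr j))) = false.
    apply/negP => /eqP eqij; have := disjointFr dXY (enum_valP i).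
    by rewrite [enum_val i]eqij enum_valP.
  have nYX i j : (f (inr (inr i)) == f (inr (inl j))) = false by rewrite eq_sym.
  move=> v w; case: (eqVneq v w) => // nvw /eqP; apply: contraTeq => _; move: nvw.
  case: v => [[]|[i|i]]; case: w => [[]|[j|j]] // nvw;
    rewrite ?nX ?nY ?nX' ?nY' ?nXY ?nYX // eq_sym ?nX ?nY ?nX' ?nY' //.
  + by apply: contraNneq nvw => /enum_val_inj ->.
  + by apply: contraNneq nvw => /enum_val_inj ->.
- have homX i : sedge x (f (inr (inl i))) := proj1 (fX i).
  have homY i : sedge y (f (inr (inr i))) := proj1 (fY i).
  move=> [[]|[i|i]] [[]|[j|j]] // _; do ?[exact: xy | exact: homX | exact: homY];
    rewrite sedge_sym; do ?[exact: xy | exact: homX | exact: homY].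
- rewrite !card_sum card_bool !card_ord.
  have eqXY : X :|: Y = ~: [set x; y].
    apply/setP => z; rewrite !inE; have [->|nzx] := eqVneq z x.
      by rewrite sedge_irrefl andbF.
    have [->|nzy] := eqVneq z y; first by rewrite sedge_irrefl !andbF.
    rewrite !andbT; case: (dom z) => [/set2P[/eqP|/eqP]|[u /set2P[]->]].
    + by rewrite (negPf nzx).
    + by rewrite (negPf nzy).
    + by rewrite sedge_sym => ->.
    + by rewrite [sedge z y]sedge_sym orbC => ->.
  have [_ eqU] := leq_card_setU X Y; move: eqU; rewrite dXY => /eqP <-.
  by rewrite eqXY -(cardsC [set x; y]) cards2 nxy.
Qed.

(** * Trees with small independent dominating sets *)

Lemma dominating_pair (G : sgraph) (u v z : G) :
  dominating [set u; v] -> z != u -> z != v -> sedge u z || sedge v z.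
Proof.
move=> /dominatingP dom nzu nzv; case: (dom z) => [|[w]].
  by rewrite !inE (negPf nzu) (negPf nzv).
by case/set2P => ->; rewrite sedge_sym => ->; rewrite ?orbT.
Qed.

Lemma dominating_pairC (G : sgraph) (u v : G) :
  dominating [set u; v] -> dominating [set v; u].
Proof. by rewrite setUC. Qed.

(** Vertices with a common neighbour are nonadjacent, so the neighbours of a
   centre must all be taken when the centre is not. *)
Lemma star_complement_sub (G : sgraph) (c : G) (S : {set G}) :
  acyclic G -> dominating [set c] -> dominating S -> c \notin S -> [set~ c] \subset S.
Proof.
move=> acG /dominatingP domc /dominatingP domS cS; apply/subsetP => z; rewrite !inE => nzc.
have adjc w : w != c -> sedge w c.
  by move=> nwc; case: (domc w) => [/set1P/eqP|[? /set1P->]] //; rewrite (negPf nwc).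
case: (domS z) => // -[s sS zs].
have nsc : s != c by apply: contraNneq cS => <-.
by have := no_triangle acG zs (adjc _ nsc); rewrite sedge_sym adjc.
Qed.

(** Since [S] misses [u] and [v], a vertex outside [S] would have a neighbour
   in [S] through which it closes a cycle of length 3 or 5. *)
Lemma common_neighbour_complement_sub (G : sgraph) (u v x : G) (S : {set G}) :
  acyclic G -> u != v -> dominating [set u; v] -> sedge u x -> sedge v x ->
  ind_dominating S -> x \in S -> ~: [set u; v] \subset S.
Proof.
move=> acG nuv domuv ux vx /andP[/independentP indS /dominatingP domS] xS.
apply/subsetP => z; rewrite !inE negb_or => /andP[nzu nzv]; apply: contraT => zS.
case: (domS z) => [zS'|[s sS zs]]; first by rewrite zS' in zS.
suff no_cycle a b : a != b -> dominating [set a; b] -> sedge a x -> sedge b x -> ~~ sedge a z.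
  move: (dominating_pair domuv nzu nzv); apply: contraLR => _; rewrite negb_or.
  by rewrite !(no_cycle u v, no_cycle v u) // 1?eq_sym // setUC.
move=> nab domab ax bx; apply/negP => az.
have aS : a \notin S by apply: contraL ax => aS; apply: indS.
have bS : b \notin S by apply: contraL bx => bS; apply: indS.
have nsa : s != a by apply: contraNneq aS => <-.
have nsb : s != b by apply: contraNneq bS => <-.
have nas : ~~ sedge a s by rewrite sedge_sym (no_triangle acG az).
have bs : sedge b s by have := dominating_pair domab nsa nsb; rewrite (negPf nas).
have nsx : s != x by apply: contraNneq nas => ->.
have nzx : z != x by apply: contraNneq zS => ->.
have nbz : b != z by apply: contraTneq az => <-; apply: no_triangle acG bx _; rewrite sedge_sym.
apply: (acG [:: a; z; s; b; x]) => //; apply/andP; split.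
  by rewrite /= az zs bx [sedge s b]sedge_sym bs sedge_sym ax.
rewrite /= !inE !negb_or [a == s]eq_sym nsa nab nsb nsx nzx [z == b]eq_sym nbz.
by rewrite !sedge_neq.
Qed.

(** A neighbour of [u] outside [S] would close a cycle of length 3 or 6 through
   [S]; and [S] also needs a vertex that dominates [v], which no neighbour of
   [u] does. *)
Lemma remote_neighbourhood_small (G : sgraph) (u x y v : G) (S : {set G}) :
  acyclic G -> dominating [set u; v] -> ~~ sedge u v -> u != v ->
  (forall z, sedge u z -> ~~ sedge v z) ->
  sedge u x -> sedge x y -> sedge y v ->
  ind_dominating S -> x \in S -> #|[set z | sedge u z]| < #|S|.
Proof.
move=> acG domuv nuv neuv far ux xy yv /andP[/independentP indS /dominatingP domS] xS.
have uS : u \notin S by apply: contraL ux => uS; apply: indS.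
have yS : y \notin S by apply: contraL xy => yS; apply: indS.
have nuy : ~~ sedge u y by apply: contraL yv => /far; rewrite sedge_sym.
apply: proper_card; apply/properP; split; last first.
  have [r [rS nur]] : exists r, r \in S /\ ~~ sedge u r.
    case: (domS v) => [vS|[s sS vs]]; first by exists v.
    by exists s; split=> //; apply: contraL vs; apply: far.
  by exists r; rewrite ?inE.
apply/subsetP => z; rewrite inE => uz; apply: contraT => zS.
case: (domS z) => [zS'|[s sS zs]]; first by rewrite zS' in zS.
have nsu : s != u by apply: contraNneq uS => <-.
have nvz := far z uz.
have nsv : s != v by apply: contraNneq nvz => <-; rewrite sedge_sym.
have nus : ~~ sedge u s by rewrite sedge_sym (no_triangle acG uz).
have vs : sedge v s by have := dominating_pair domuv nsu nsv; rewrite (negPf nus).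
have nsy : s != y by apply: contraNneq yS => <-.
have nsx : s != x by apply: contraNneq nus => ->.
have nzx : z != x by apply: contraNneq zS => ->.
have nzv : z != v by apply: contraNneq nuv => <-.
have nzy : z != y by apply: contraNneq nuy => <-.
have nvx : v != x by apply: contraNneq nuv => ->.
have neuy : u != y by apply: contraNneq nuv => ->.
exfalso; apply: (acG [:: u; z; s; v; y; x]) => //; apply/andP; split.
  by rewrite /= uz zs [sedge s v]sedge_sym vs [sedge v y]sedge_sym yv [sedge y x]sedge_sym xy sedge_sym ux.
rewrite /= !inE !negb_or [u == s]eq_sym nsu neuv neuy nsv nsy nsx nzx nzv nzy nvx.
by rewrite [v == y]eq_sym [y == x]eq_sym !sedge_neq.
Qed.

(** The common neighbour [x] lies in an independent dominating set of at most
   three vertices, which contains everything but [u] and [v]. So there are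
   five vertices, and the last two are leaves at [u] or [v]. *)
Lemma common_neighbour_isomorphic (G : sgraph) (u v x : G) (S : {set G}) :
  acyclic G -> u != v -> dominating [set u; v] -> sedge u x -> sedge v x ->
  ind_dominating S -> x \in S -> #|S| <= 3 -> 4 < #|G| ->
  isomorphic G (path_graph 5) \/ isomorphic G (double_star 1 2).
Proof.
move=> acG nuv domuv ux vx idS xS S3 G4.
have sCS := common_neighbour_complement_sub acG nuv domuv ux vx idS xS.
have cardC := cardsC [set u; v]; rewrite cards2 nuv in cardC.
have /eqP eqS : ~: [set u; v] == S.
  by rewrite eqEcard sCS; move: cardC S3 G4; lia.
have G5 : #|G| = 5 by move: cardC S3 G4 (subset_leq_card sCS); lia.
have /eqP/cards2P[p [q [npq eqpq]]] : #|S :\ x| = 2.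
  have := cardsD1 x S; rewrite xS -eqS; move: cardC G5; lia.
have /independentP indS : independent S by case/andP: idS.
have /andP[npx pS] : (p != x) && (p \in S) by rewrite -in_setD1 eqpq set21.
have /andP[nqx qS] : (q != x) && (q \in S) by rewrite -in_setD1 eqpq set22.
have outS w : w \in S -> w != u /\ w != v.
  by rewrite -eqS !inE negb_or => /andP.
have [[npu npv] [nqu nqv]] := (outS p pS, outS q qS).
have path5 a b r s : [&& r != s, r != a, r != b, r != x, s != a, s != b & s != x] ->
    sedge a x -> sedge b x -> a != b -> sedge a r -> sedge b s ->
    isomorphic G (path_graph 5).
  move=> /and5P[nrs nra nrb nrx /and3P[nsa nsb nsx]] ax bx nab ar bs.
  apply: (@spanning_path_isomorphic _ r [:: a; x; b; s]) => //=.
    by rewrite ax bs sedge_sym ar sedge_sym bx.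
  rewrite !inE !negb_or nra nrx nrb nrs nab [a == s]eq_sym nsa [x == s]eq_sym nsx.
  by rewrite !sedge_neq // sedge_sym.
have double12 a b : [set a; b] = [set u; v] -> a != b ->
    sedge a x -> sedge b x -> sedge b p -> sedge b q -> isomorphic G (double_star 1 2).
  move=> eqab nab ax bx bp bq.
  have cases z : z = a \/ z = b \/ z = x \/ z = p \/ z = q.
    have [|] := boolP (z \in [set a; b]); first by case/set2P; auto.
    rewrite eqab -in_setC eqS; have [->|nzx] := eqVneq z x; first by auto.
    move=> zS; have : z \in S :\ x by rewrite in_setD1 nzx.
    by rewrite eqpq => /set2P[]; auto 6.
  have nba : ~~ sedge b a.
    by rewrite sedge_sym; apply: no_triangle acG bx _; rewrite sedge_sym.
  have [xp xq] : ~~ sedge x p /\ ~~ sedge x q by split; apply: indS.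
  have domxb : dominating [set x; b].
    apply/dominatingP => z; rewrite !inE.
    case: (cases z) => [|[|[|[|]]]] ->; rewrite ?eqxx ?orbT; auto; right.
    - by exists x; rewrite ?set21.
    - by exists b; rewrite ?set22 // sedge_sym.
    - by exists b; rewrite ?set22 // sedge_sym.
  have xb : sedge x b by rewrite sedge_sym.
  have := double_star_isomorphic acG xb domxb.
  have -> : [set z | sedge x z & z != b] = [set a].
    apply/setP => z; rewrite !inE; apply/idP/eqP => [|->]; last by rewrite sedge_sym ax.
    case: (cases z) => [|[|[|[|]]]] -> //; rewrite ?eqxx ?andbF ?sedge_irrefl //.
      by rewrite (negPf xp).
    by rewrite (negPf xq).
  have -> : [set z | sedge b z & z != x] = [set p; q].
    apply/setP => z; rewrite !inE; apply/idP/idP => [|/orP[]/eqP->]; last first.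
    - by rewrite bq.
    - by rewrite bp.
    case: (cases z) => [|[|[|[|]]]] ->; rewrite ?eqxx ?andbF ?orbT ?sedge_irrefl //.
    by rewrite (negPf nba).
  by rewrite cards1 cards2 npq.
have eqvu := setUC [set v] [set u].
have nvu : v != u by rewrite eq_sym.
have nqp : q != p by rewrite eq_sym.
case/orP: (dominating_pair domuv npu npv) => [up|vp];
  case/orP: (dominating_pair domuv nqu nqv) => [uq|vq].
- by right; apply: (double12 v u).
- by left; apply: (path5 u v p q) => //; rewrite npq npu npv npx nqu nqv nqx.
- by left; apply: (path5 u v q p) => //; rewrite nqp npu npv npx nqu nqv nqx.
- by right; apply: (double12 u v).
Qed.

(** A leaf of a star only lies in the independent dominating set of all
   leaves. *)
Lemma center_isomorphic (G : sgraph) (c : G) :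
  acyclic G -> 3 < #|G| -> dominating [set c] ->
  (forall v : G, exists S : {set G}, [/\ v \in S, ind_dominating S & #|S| <= 3]) ->
  isomorphic G (complete_bipartite 1 3).
Proof.
move=> acG G3 domc small; have iso := star_isomorphic acG domc.
have cardc : #|[set~ c]| = #|G|.-1 by rewrite cardsC1.
suff c3 : #|[set~ c]| = 3 by rewrite c3 in iso.
have [z nzc] : exists z, z \in [set~ c] by apply/set0Pn; rewrite -card_gt0; lia.
have [S [zS /andP[/independentP indS domS] S3]] := small z.
have cS : c \notin S.
  move/dominatingP: domc => /(_ z)[|[_ /set1P-> zc]].
    by rewrite !inE in nzc; rewrite inE (negPf nzc).
  by apply: contraL zc => cS; apply: indS.
have := subset_leq_card (star_complement_sub acG domc domS cS); lia.
Qed.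

(** By connectedness an edge leaves the closed neighbourhood of [u]. It starts at
   a neighbour of [u], which is not adjacent to [v], so it ends at a neighbour
   of [v]. *)
Lemma dominating_pair_link (G : sgraph) (u v : G) :
  connected G -> u != v -> dominating [set u; v] -> ~~ sedge u v ->
  (forall z, sedge u z -> ~~ sedge v z) ->
  exists x y, [/\ sedge u x, sedge x y & sedge y v].
Proof.
move=> [_ conG] neuv domuv nuv far.
pose N := [pred z | (z == u) || sedge u z].
have [x [y [Nx Ny xy]]] : exists x y, [/\ N x, ~~ N y & sedge x y].
  have leave p w : N w -> path sedge w p -> ~~ N (last w p) ->
      exists x y, [/\ N x, ~~ N y & sedge x y].
    elim: p w => [|t p IHp] w Nw /=; first by move: Nw => /= ->.
    case/andP=> wt pathp nN; have [Nt|nNt] := boolP (N t); last by exists w, t.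
    exact: (IHp t).
  case/connectP: (conG u v) => p pathp eqv; apply: (leave p u) => //.
    by rewrite /= eqxx.
  by rewrite -eqv /= negb_or eq_sym neuv.
move: Ny; rewrite /= negb_or => /andP[nyu nuy].
have ux : sedge u x.
  by case/orP: Nx => // /eqP eqx; rewrite eqx (negPf nuy) in xy.
have nyv : y != v by apply: contraTneq xy => ->; rewrite sedge_sym far.
exists x, y; split=> //.
by have := dominating_pair domuv nyu nyv; rewrite (negPf nuy) /= sedge_sym.
Qed.

(** An independent set of three vertices in a connected graph on four makes the
   fourth a centre, so a tree without a centre has at least five vertices, and
   its independent dominating set of at most two vertices is a pair. *)
Lemma tree_classification (T : sgraph) : is_tree T ->
  (forall v : T, exists S : {set T}, [/\ v \in S, ind_dominating S & #|S| <= 3]) ->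
  (exists2 S : {set T}, ind_dominating S & #|S| = 3) ->
  (exists2 S : {set T}, ind_dominating S & #|S| <= 2) ->
  [\/ isomorphic T (path_graph 5), isomorphic T (path_graph 6),
      isomorphic T (double_star 1 2) | isomorphic T (complete_bipartite 1 3)].
Proof.
move=> [conT acT] small [I idI I3] [D idD D2].
have T1 : 1 < #|T| by apply: leq_trans (max_card (mem I)); rewrite I3.
have T3 : 3 < #|T|.
  by rewrite -I3 independent_ltn_card -?card_gt0 ?I3 //; case/andP: idI.
have [/existsP[c domc]|/existsPn no_center] := boolP [exists c : T, dominating [set c]].
  by constructor 4; apply: center_isomorphic acT T3 domc small.
have T4 : 4 < #|T|.
  rewrite ltn_neqAle T3 andbT eq_sym; apply/negP => /eqP T4.
  have := cardsC I; rewrite I3 T4 => -[] /eqP/cards1P[c eqc].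
  have /negP[] := no_center c; apply/dominatingP => z.
  have [zI|zI] := boolP (z \in I); last by left; rewrite -eqc inE.
  right; have [w zw] := connected_neighbour z conT T1; exists w => //.
  rewrite -eqc inE; apply: contraL zw => wI.
  by case/andP: idI => /independentP indI _; apply: indI.
have common (u v x : T) : u != v -> dominating [set u; v] -> sedge u x -> sedge v x ->
    isomorphic T (path_graph 5) \/ isomorphic T (double_star 1 2).
  move=> nuv domuv ux vx; have [S [xS idS S3]] := small x.
  exact: (common_neighbour_isomorphic acT nuv domuv ux vx idS xS S3 T4).
have /andP[/independentP indD domD] := idD.
have [u [v [neuv eqD]]] : exists u v : T, u != v /\ D = [set u; v].
  apply/cards2P; rewrite eqn_leq D2; case: (ltngtP #|D| 1) => [||/eqP/cards1P[c eqD]] //.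
    rewrite ltnS leqn0 cards_eq0 => /eqP eqD.
    have /card_gt0P[z _] : 0 < #|T| by case: conT.
    by case/dominatingP/(_ z): domD => [|[w]]; rewrite eqD inE.
  by have /negP[] := no_center c; rewrite -eqD.
rewrite eqD in domD.
have nuv : ~~ sedge u v by apply: indD; rewrite eqD ?set21 ?set22.
have [/existsP[x /andP[ux vx]]|/existsPn far'] := boolP [exists x, sedge u x && sedge v x].
  by case: (common u v x neuv domD ux vx); [constructor 1 | constructor 3].
have far z : sedge u z -> ~~ sedge v z by move=> uz; have := far' z; rewrite uz.
have farC z : sedge v z -> ~~ sedge u z by apply: contraL; apply: far.
have [x [y [ux xy yv]]] := dominating_pair_link conT neuv domD nuv far.
have vy : sedge v y by rewrite sedge_sym.
have yx : sedge y x by rewrite sedge_sym.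
have xu : sedge x u by rewrite sedge_sym.
(* If [u] is a leaf then its neighbour can replace it in the pair, and
   likewise for [v]. *)
have leaf (a b c d : T) : dominating [set a; d] -> sedge a b -> sedge b c -> sedge c d ->
    b != d -> (forall z, sedge a z -> z = b) ->
    isomorphic T (path_graph 5) \/ isomorphic T (double_star 1 2).
  move=> domad ab bc cd nbd leafa; apply: (common b d c) => //; last by rewrite sedge_sym.
  apply/dominatingP => z; have [->|nza] := eqVneq z a.
    by right; exists b; rewrite ?set21.
  have [->|nzd] := eqVneq z d; first by left; rewrite set22.
  case/orP: (dominating_pair domad nza nzd) => [/leafa ->|dz]; first by left; rewrite set21.
  by right; exists d; rewrite ?set22 // sedge_sym.
have nxv : x != v by apply: contraNneq nuv => <-.
have nyu : y != u by apply: contraNneq nuv => <-; rewrite sedge_sym.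
have [/existsP[p /andP[up npx]]|/existsPn leafu] := boolP [exists p, sedge u p && (p != x)]; last first.
  case: (leaf u x y v) => // [z uz||]; [|by constructor 1|by constructor 3].
  by apply/eqP; have := leafu z; rewrite uz negbK.
have [/existsP[q /andP[vq nqy]]|/existsPn leafv] := boolP [exists q, sedge v q && (q != y)]; last first.
  case: (leaf v y x u) => // [|z vz||]; [exact: dominating_pairC| |by constructor 1|by constructor 3].
  by apply/eqP; have := leafv z; rewrite vz negbK.
have Nu z : sedge u z -> z = x \/ z = p.
  have [S [xS idS S3]] := small x.
  have := remote_neighbourhood_small acT domD nuv neuv far ux xy yv idS xS.
  move=> /leq_trans/(_ S3); rewrite ltnS => N2 uz.
  have /eqP eqN : [set x; p] == [set z | sedge u z].
    rewrite eqEcard cards2 [x == p]eq_sym npx N2 andbT.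
    by apply/subsetP => w /set2P[]->; rewrite inE.
  by apply/set2P; rewrite eqN inE.
have Nv z : sedge v z -> z = y \/ z = q.
  have [S [yS idS S3]] := small y.
  have nvu : ~~ sedge v u by rewrite sedge_sym.
  have nevu : v != u by rewrite eq_sym.
  have := remote_neighbourhood_small acT (dominating_pairC domD) nvu nevu farC vy yx xu idS yS.
  move=> /leq_trans/(_ S3); rewrite ltnS => N2 vz.
  have /eqP eqN : [set y; q] == [set z | sedge v z].
    rewrite eqEcard cards2 [y == q]eq_sym nqy N2 andbT.
    by apply/subsetP => w /set2P[]->; rewrite inE.
  by apply/set2P; rewrite eqN inE.
have uniq6 : uniq [:: p; u; x; y; v; q].
  have npy : p != y by apply: contraTneq up => ->; apply: farC.
  have npv : p != v by apply: contraNneq nuv => <-.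
  have npq : p != q by apply: contraTneq up => ->; apply: farC.
  have nuq : u != q by apply: contraNneq nuv => ->; rewrite sedge_sym.
  have nxq : x != q by apply: contraTneq ux => ->; apply: farC.
  rewrite /= !inE !negb_or npx npy npv npq nuq nxq neuv [u == y]eq_sym nyu nxv [y == q]eq_sym nqy.
  by rewrite !sedge_neq // sedge_sym.
constructor 2; apply: (@spanning_path_isomorphic _ p [:: u; x; y; v; q]) => //.
  by rewrite /= ux xy yv vq sedge_sym up.
rewrite -(card_uniqP uniq6); apply: eq_card => z; rewrite !inE; symmetry.
have [->|nzu] := eqVneq z u; rewrite ?orbT //.
have [->|nzv] := eqVneq z v; rewrite ?orbT //.
by case/orP: (dominating_pair domD nzu nzv) => [/Nu|/Nv] [] ->; rewrite eqxx ?orbT.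
Qed.

(** * Invariance under isomorphism *)

Section Isomorphism.

Lemma isomorphic_sym (G H : sgraph) : isomorphic G H -> isomorphic H G.
Proof.
move=> [f [g fK gK] monof]; exists g => [|x y]; first by exists f.
by rewrite -monof !gK.
Qed.

Variables (G H : sgraph) (f : G -> H).
Hypotheses (bijf : bijective f) (monof : {mono f : x y / sedge x y}).

Let injf : injective f := bij_inj bijf.

Lemma ind_dominating_imset (S : {set G}) :
  ind_dominating S -> ind_dominating (f @: S).
Proof.
case/andP=> /independentP indS /dominatingP domS; apply/andP; split.
  by apply/independentP => _ _ /imsetP[x xS ->] /imsetP[y yS ->]; rewrite monof indS.
have [g fK gK] := bijf.
apply/dominatingP => v; rewrite -[v]gK mem_imset //.
case: (domS (g v)) => [|[u uS vu]]; [by left | right].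
by exists (f u); rewrite ?imset_f ?monof.
Qed.

Lemma ic_partition_imset (P : {set {set G}}) :
  ic_partition P -> ic_partition [set f @: (A : {set G}) | A in P].
Proof.
move=> icP; have partP : partition P [set: G] by case/andP: icP.
have imT : f @: [set: G] = [set: H].
  by apply/eqP; rewrite eqEcard subsetT card_imset // !cardsT (bij_eq_card bijf) leqnn.
have partfP : partition [set f @: (A : {set G}) | A in P] [set: H].
  by rewrite -imT imset_partition.
apply/(ic_partitionP partfP) => _ /imsetP[A AP ->]; rewrite card_imset //.
case/(ic_partitionP partP)/(_ _ AP): icP => [[A1 domA]|[B BP [nBA idAB]]].
  left; split=> //; suff /andP[] : ind_dominating (f @: A) by [].
  exact: ind_dominating_imset (ind_dominating_card1 A1 domA).
right; exists (f @: B); first exact: imset_f.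
by rewrite (inj_eq (imset_inj injf)) -imsetU ind_dominating_imset.
Qed.

End Isomorphism.

Lemma IC_is_isomorphic (G H : sgraph) (t : nat) :
  isomorphic G H -> IC_is H t -> IC_is G t.
Proof.
move=> isoGH; have [g bijg monog] := isomorphic_sym isoGH.
case: isoGH => [f bijf monof] [[P icP cardP] maxt]; split.
  exists [set g @: (A : {set H}) | A in P]; first exact: ic_partition_imset.
  by rewrite card_imset //; apply: imset_inj; apply: bij_inj.
move=> Q icQ; rewrite -(card_imset _ (imset_inj (bij_inj bijf))).
by apply: maxt; apply: ic_partition_imset.
Qed.

(** * The graphs on the list *)

Section Certificate.

Variable G : sgraph.
Implicit Types (x y z a b : G) (s vs : seq G).

(** Independent domination by the entries of [s], tested along the list [vs] of
   all vertices so that it evaluates on a concrete graph. *)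
Definition ind_dominating_seq vs s : bool :=
  allrel (fun x y => ~~ sedge x y) s s &&
  all (fun v => (v \in s) || has (sedge v) s) vs.

Lemma ind_dominating_seqE vs s (S : {set G}) :
  (forall v, v \in vs) -> S =i s -> ind_dominating S = ind_dominating_seq vs s.
Proof.
move=> vsT eqS; congr (_ && _).
  apply/independentP/allrelP => indS u v; last by rewrite !eqS; apply: indS.
  by rewrite -!eqS; apply: indS.
apply/dominatingP/allP => domS v.
  move=> _; apply/orP; rewrite -eqS; case: (domS v) => [|[u uS vu]]; first by left.
  by right; apply/hasP; exists u; rewrite -?eqS.
rewrite eqS; case/orP: (domS v (vsT v)) => [|/hasP[u us vu]]; first by left.
by right; exists u; rewrite ?eqS.
Qed.

(** Merging [a] and [b] and leaving the other vertices alone gives an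
   ic-partition; the vertex [z], in no independent dominating set of at most
   two vertices, excludes the partition into singletons. *)
Definition merge_certificate vs a b z : bool :=
  let others := [seq x <- vs | (x != a) && (x != b)] in
  let small x := ind_dominating_seq vs [:: x] ||
                 has (fun y => (y != x) && ind_dominating_seq vs [:: x; y]) others in
  [&& a != b,
      has (fun w => ind_dominating_seq vs [:: a; b; w]) others,
      all (fun x => small x || ind_dominating_seq vs [:: a; b; x]) others
    & all (fun y => ~~ ind_dominating_seq vs [:: z; y]) vs].

Lemma merge_certificate_IC vs a b z :
  (forall v, v \in vs) -> merge_certificate vs a b z -> IC_is G (#|G| - 1).
Proof.
move=> vsT /and4P[nab hasw /allP alls /allP noz].
set others := filter _ _ in hasw alls.
have mem_others x : (x \in others) = (x \notin [set a; b]).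
  by rewrite mem_filter vsT andbT !inE negb_or.
have id1 x : ind_dominating [set x] = ind_dominating_seq vs [:: x].
  by apply: ind_dominating_seqE => // w; rewrite !inE.
have id2 x y : ind_dominating [set x; y] = ind_dominating_seq vs [:: x; y].
  by apply: ind_dominating_seqE => // w; rewrite !inE.
have id3 x : ind_dominating ([set a; b] :|: [set x]) = ind_dominating_seq vs [:: a; b; x].
  by apply: ind_dominating_seqE => // w; rewrite !inE orbA.
split; last first.
  move=> P icP; rewrite leqNgt; apply/negP => ltP.
  have [S [zS idS]] := ic_partition_small z icP.
  rewrite (_ : #|G| - #|P| = 0); last by lia.
  rewrite (cardsD1 z) zS ltnS => Sz.
  suff [y eqS] : exists y, S = [set z; y] by move: (noz y (vsT y)); rewrite -id2 -eqS idS.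
  case: (ltngtP #|S :\ z| 1) Sz => // [Sz|/eqP/cards1P[y eqSz]] _.
    exists z; move: Sz; rewrite ltnS leqn0 cards_eq0 => /eqP Sz.
    by rewrite -(setD1K zS) Sz setU0 setUid.
  by exists y; rewrite -(setD1K zS) eqSz.
pose single := [set [set x] | x in ~: [set a; b]].
have memP A : reflect (A = [set a; b] \/ exists2 x, x \in others & A = [set x])
                      (A \in [set a; b] |: single).
  apply: (iffP setU1P) => -[->|]; [by left| |by left|].
    by case/imsetP => x; rewrite in_setC -mem_others; right; exists x.
  by move=> [x]; rewrite mem_others => nx ->; right; apply: imset_f; rewrite in_setC.
have single0 : [set a; b] \notin single.
  apply/negP => /imsetP[x _ eqx]; have := cards1 x; rewrite -eqx cards2 nab; lia.
have partP : partition ([set a; b] |: single) [set: G].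
  apply/and3P; split.
  - apply/eqP/setP => x; rewrite inE; apply/bigcupP.
    have [xab|xab] := boolP (x \in [set a; b]); first by exists [set a; b]; rewrite ?setU11.
    exists [set x]; rewrite ?set11 //; apply/memP; right.
    by exists x; rewrite ?mem_others.
  - apply/trivIsetP => A B /memP[->|[x ox ->]] /memP[->|[y oy ->]].
    + by rewrite eqxx.
    + by move=> _; rewrite disjoint_sym disjoints1 -mem_others.
    + by move=> _; rewrite disjoints1 -mem_others.
    + by move=> nxy; rewrite disjoints1 inE; apply: contraNneq nxy => ->.
  - apply/negP => /memP[|[x _]] /setP.
      by move=> /(_ a); rewrite !inE eqxx.
    by move=> /(_ x); rewrite !inE eqxx.
exists ([set a; b] |: single); last first.
  rewrite cardsU1 single0 card_imset; last exact: set1_inj.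
  have := cardsC [set a; b]; rewrite cards2 nab; lia.
apply/(ic_partitionP partP) => A /memP[->|[x ox ->]].
  case/hasP: hasw => w ow idw; right; exists [set w].
    by apply/memP; right; exists w.
  split; last by rewrite id3.
  by apply: contraNneq single0 => <-; apply: imset_f; rewrite in_setC -mem_others.
case/orP: (alls x ox) => [/orP[idx|/hasP[y oy /andP[nyx idxy]]]|idx].
- by left; rewrite cards1; move: idx; rewrite -id1 => /andP[].
- right; exists [set y]; first by apply/memP; right; exists y.
  by rewrite id2 (inj_eq set1_inj).
- right; exists [set a; b]; first by apply/memP; left.
  rewrite [[set x] :|: _]setUC id3; split=> //.
  by apply: contraNneq single0 => ->; apply: imset_f; rewrite in_setC -mem_others.
Qed.

End Certificate.

(** Numbered along the path, {1, 3} and {0, 2, 4} are independent dominating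
   sets, and one that contains 2 misses 1 and 3, hence contains 0 and 4. *)
Lemma IC_path5 : IC_is (path_graph 5) (#|path_graph 5| - 1).
Proof.
pose v i (lti : i < 5) : path_graph 5 := Ordinal lti.
apply: (@merge_certificate_IC (path_graph 5)
          [:: v 0 isT; v 1 isT; v 2 isT; v 3 isT; v 4 isT]
          (v 0 isT) (v 4 isT) (v 2 isT)); last by [].
by case=> [[|[|[|[|[|]]]]]].
Qed.

(** Numbered along the path, {1, 4}, {0, 2, 5} and {0, 3, 5} are independent
   dominating sets, and one that contains 2 misses 1 and 3, hence contains 0, as
   well as 4 or 5. *)
Lemma IC_path6 : IC_is (path_graph 6) (#|path_graph 6| - 1).
Proof.
pose v i (lti : i < 6) : path_graph 6 := Ordinal lti.
apply: (@merge_certificate_IC (path_graph 6)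
          [:: v 0 isT; v 1 isT; v 2 isT; v 3 isT; v 4 isT; v 5 isT]
          (v 0 isT) (v 5 isT) (v 2 isT)); last by [].
by case=> [[|[|[|[|[|[|]]]]]]].
Qed.

(** The leaves [p] and [q] share a support, which is paired with the third
   leaf. An independent dominating set that contains [p] misses that support,
   hence contains [q], and one more vertex for the third leaf. *)
Lemma IC_double_star12 : IC_is (double_star 1 2) (#|double_star 1 2| - 1).
Proof.
pose p : double_star 1 2 := inr (inr (@Ordinal 2 0 isT)).
pose q : double_star 1 2 := inr (inr (@Ordinal 2 1 isT)).
apply: (@merge_certificate_IC (double_star 1 2)
          [:: inl true; inl false; inr (inl ord0); p; q] p q p); last by [].
by case=> [[]|[[[|]]|[[|[|]]]]].
Qed.

(** A leaf lies in no independent dominating set besides that of all leaves,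
   and the support is a singleton dominating set. *)
Lemma IC_star3 : IC_is (complete_bipartite 1 3) (#|complete_bipartite 1 3| - 1).
Proof.
pose leaf i (lti : i < 3) : complete_bipartite 1 3 := inr (Ordinal lti).
apply: (@merge_certificate_IC (complete_bipartite 1 3)
          [:: inl ord0; leaf 0 isT; leaf 1 isT; leaf 2 isT]
          (leaf 0 isT) (leaf 1 isT) (leaf 0 isT)); last by [].
by case=> [[[|]]|[[|[|[|]]]]].
Qed.

(** * The classification *)

Theorem theorem5p14 (n : nat) (T : sgraph) (hT : is_tree T) (hn : #|T| = n) :
  IC_is T (n - 1) <->
  [\/ isomorphic T (path_graph 5), isomorphic T (path_graph 6),
      isomorphic T (double_star 1 2) | isomorphic T (complete_bipartite 1 3)].
Proof.
subst n; split=> [[[P icP cardP] _]|].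
  have [conT _] := hT.
  have [] := ic_partition_pred_card conT icP cardP.
  exact: tree_classification.
have transfer H : IC_is H (#|H| - 1) -> isomorphic T H -> IC_is T (#|T| - 1).
  move=> icH isoTH; have [f bijf _] := isoTH.
  by rewrite (bij_eq_card bijf); apply: IC_is_isomorphic isoTH icH.
case; apply: transfer.
- exact: IC_path5.
- exact: IC_path6.
- exact: IC_double_star12.
- exact: IC_star3.
Qed.
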